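(* Let $n\geq 3$. Then the sets on the right-hand side below are pairwise disjoint and \begin{multline*} \mathcal{J}(\mathcal{L}_{n+1})= \left(\mathcal{J}(\mathcal{L}_n)\cap \mathrm{Cl}(n) \right)^{\downarrow_1} \sqcup \left(\mathcal{J}(\mathcal{L}_n)\cap \mathrm{NP}(n) \right)^{\downarrow_1} \sqcup \left(\mathcal{J}(\mathcal{L}_n)\cap \mathrm{Ss}(n) \right)^{\downarrow_2}\\ \sqcup \left(\mathcal{J}(\mathcal{L}_n)\cap \mathrm{NS}(n) \right)^{\downarrow_2} \sqcup\bigsqcup_{1\leq l <n} \left(\mathcal{J}(\mathcal{L}_n)\cap \mathrm{PP}_l(n) \right)^{\downarrow_{l+2}} \sqcup E_1(n+1) \sqcup E_2(n+1), \end{multline*} where $E_1(n+1)=\{(2,1,\ldots,1)\}$ (the partition of $n+1$ with one part $2$ and $n-1$ parts $1$) and $E_2(n+1)$ is the set of partitions of $n+1$ of the form $(3,\ldots,3,1,\ldots,1)$ with $m\geq1$ parts equal to $3$ followed by $l\geq 1$ parts equal to $1$.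
   Context: A partition of a positive integer $n$ is an $n$-tuple $\vec\alpha=(a_1,\ldots,a_n)$ of natural numbers with $a_1\geq\cdots\geq a_n\geq0$ and $\sum a_i=n$ (trailing zeros may be omitted; set $a_i=0$ for $i>n$). The dominance ordering: $(a_i)\geq(b_i)$ iff $\sum_{i=1}^j a_i\geq\sum_{i=1}^j b_i$ for all $j\geq1$; the partitions of $n$ with this order form a lattice $\mathcal{L}_n$, and $\mathcal{J}(\mathcal{L}_n)$ is its set of join-irreducible elements (elements covering exactly one element). For a partition $\vec\alpha=(a_1,\ldots,a_n)$ of $n$ and $i\in\{1,\ldots,n\}$, $\vec\alpha^{\downarrow_i}$ is the $(n+1)$-tuple $(a_1,\ldots,a_{i-1},a_i+1,a_{i+1},\ldots,a_n,0)$, and $\vec\alpha^{\downarrow_{n+1}}=(a_1,\ldots,a_n,1)$; for a set $A$ of partitions, $A^{\downarrow_i}=\{\vec\alpha^{\downarrow_i}:\vec\alpha\in A\}$. Let $d_j(\vec\alpha)=a_j-a_{j+1}$. $\vec\alpha$ has a cliff at $j$ if $d_j(\vec\alpha)\geq2$; a slippery plateau of length $k-j$ at $j$ if there is $k>j$ with $d_i(\vec\alpha)=0$ for all $i\in\{j,\ldots,k-1\}$ and $d_k(\vec\alpha)=1$; a non-slippery plateau (of length $k-j$) at $j$ if there is $k>j$ with $d_i(\vec\alpha)=0$ for $i\in\{j,\ldots,k-1\}$ and $\vec\alpha$ has a cliff at $k$; a slippery step at $j$ if $(a_1,\ldots,a_j-1,\ldots,a_n)$ is a partition with a slippery plateau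 at $j$; a non-slippery step at $j$ if $(a_1,\ldots,a_j-1,\ldots,a_n)$ is a partition with a non-slippery plateau at $j$. $\mathrm{Cl}(n)$, $\mathrm{Ss}(n)$, $\mathrm{NS}(n)$, $\mathrm{PP}_l(n)$, $\mathrm{NP}(n)$ denote the sets of partitions of $n$ having, respectively, a cliff at $1$, a slippery step at $1$, a non-slippery step at $1$, a slippery plateau of length $l\geq1$ at $1$, and a non-slippery plateau at $1$. *)

(* Defs.v *)
From HB Require Import structures.
From mathcomp Require Import all_boot all_order.
From mathcomp Require Import boolp classical_sets.

Set Implicit Arguments.
Unset Strict Implicit.
Unset Printing Implicit Defensive.

Import Order.TTheory.
Local Open Scope classical_set_scope.

(* Entries are numbered from 1, and [part a i = 0] beyond the end of [a].
   Index 0 is never used (it would alias index 1). *)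
Definition part (a : seq nat) (i : nat) : nat := nth 0 a i.-1.

Definition is_part (n : nat) (a : seq nat) : bool :=
  sorted geq a && (sumn a == n).

Record intpart (n : nat) := IntPart {
  pval :> n.-tuple nat;
  _ : is_part n pval
}.

HB.instance Definition _ n := [isSub for @pval n].
HB.instance Definition _ n := [Choice of intpart n by <:].

Section Dominance.
Variable n : nat.
Implicit Types a b c : intpart n.

Definition psum (a : seq nat) (j : nat) : nat := \sum_(1 <= i < j.+1) part a i.

Definition dominated a b : bool :=
  `[< forall j, 1 <= j -> psum a j <= psum b j >].

Lemma dominated_refl : reflexive dominated.
Proof. by move=> a; apply/asboolP. Qed.

Lemma dominated_anti : antisymmetric dominated.
Proof.
move=> a b /andP[/asboolP ab /asboolP ba].
have eq_psum j : psum a j = psum b j.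
  case: j => [|j]; first by rewrite /psum !big_geq.
  by apply/eqP; rewrite eqn_leq ab ?ba.
apply/val_inj/val_inj/(@eq_from_nth _ 0); first by rewrite !size_tuple.
move=> i _; have := eq_psum i.+1.
rewrite /psum big_nat_recr // [RHS]big_nat_recr //=.
by rewrite -/(psum a i) -/(psum b i) eq_psum => /addnI.
Qed.

Lemma dominated_trans : transitive dominated.
Proof.
move=> b a c /asboolP ab /asboolP bc; apply/asboolP => j j1.
exact: leq_trans (ab j j1) (bc j j1).
Qed.

End Dominance.

Fact dominance_display : Order.disp_t. Proof. exact: Order.Disp tt tt. Qed.

(* The poset underlying the lattice L_n. *)
HB.instance Definition _ n :=
  Order.Le_isPOrder.Build dominance_display (intpart n)
    (@dominated_refl n) (@dominated_anti n) (@dominated_trans n).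

Definition covers d (T : porderType d) (x y : T) : Prop :=
  (y < x)%O /\ ~ exists z, (y < z < x)%O.

Definition join_irr d (T : porderType d) : set T :=
  [set x | exists! y, covers x y].

Definition J (n : nat) : set (intpart n) := @join_irr _ (intpart n).

(* [a] has n entries and the result n + 1: when i = n + 1 the entry added to
   is the appended 0. *)
Definition darrow n (i : nat) (a : intpart n) : n.+1.-tuple nat :=
  [tuple part a k.+1 + (k.+1 == i) | k < n.+1].

(* The truncated difference is exact on weakly decreasing sequences. *)
Definition d (a : seq nat) (j : nat) : nat := part a j - part a j.+1.

Definition cliff (a : seq nat) (j : nat) : Prop := 2 <= d a j.

Definition slippery_plateau_of_length (l : nat) (a : seq nat) (j : nat) : Prop :=
  exists k, [/\ j < k, k - j = l, forall i, j <= i < k -> d a i = 0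
              & d a k = 1].

Definition slippery_plateau (a : seq nat) (j : nat) : Prop :=
  exists l, slippery_plateau_of_length l a j.

Definition non_slippery_plateau (a : seq nat) (j : nat) : Prop :=
  exists k, [/\ j < k, forall i, j <= i < k -> d a i = 0 & cliff a k].

Definition decr (a : seq nat) (j : nat) : seq nat :=
  set_nth 0 a j.-1 (part a j).-1.

(* [0 < part a j] makes [part a j - 1] a genuine subtraction. *)
Definition slippery_step n (a : intpart n) (j : nat) : Prop :=
  [/\ 0 < part a j, is_part n.-1 (decr a j) & slippery_plateau (decr a j) j].

Definition non_slippery_step n (a : intpart n) (j : nat) : Prop :=
  [/\ 0 < part a j, is_part n.-1 (decr a j)
    & non_slippery_plateau (decr a j) j].

Definition Cl n : set (intpart n) := [set a | cliff a 1].
Definition Ss n : set (intpart n) := [set a | slippery_step a 1].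
Definition NS n : set (intpart n) := [set a | non_slippery_step a 1].
Definition PP n (l : nat) : set (intpart n) :=
  [set a | slippery_plateau_of_length l a 1].
Definition NP n : set (intpart n) := [set a | non_slippery_plateau a 1].

(* The partition without its trailing zeros. *)
Definition nonzero_parts (a : seq nat) : seq nat := [seq x <- a | 0 < x].

(* Indexed by the integer being partitioned. *)
Definition E1 (N : nat) : set (intpart N) :=
  [set a | nonzero_parts a = 2 :: nseq (N - 2) 1].

Definition E2 (N : nat) : set (intpart N) :=
  [set a | exists m l, [/\ 1 <= m, 1 <= l
    & nonzero_parts a = nseq m 3 ++ nseq l 1]].

Arguments J : clear implicits.
Arguments Cl : clear implicits.
Arguments Ss : clear implicits.
Arguments NS : clear implicits.
Arguments PP : clear implicits.
Arguments NP : clear implicits.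
Arguments E1 : clear implicits.
Arguments E2 : clear implicits.

(* Main.v *)
Require Import Defs.
From mathcomp Require Import all_boot all_order.
From mathcomp Require Import boolp classical_sets.
From mathcomp Require Import zify.
Local Open Scope classical_set_scope.
Import Order.TTheory.

Set Implicit Arguments.
Unset Strict Implicit.
Unset Printing Implicit Defensive.

(* The lower covers of a partition [a] are obtained by moving one unit from
   part [j] to part [k + 1] along the minimal intervals [j, k] with
   [a_j - a_(k+1) >= 2]. Hence [a] is join-irreducible exactly when there is
   one such interval, which forces its Young diagram to have [c] columns of a
   common length [q], possibly one longer column [r] and one shorter column [p],
   where [c >= 2], or [c = 1] and only [p] is present. In terms of [(p, q, c, r)]
   each arrow lengthens one column by a unit, so the pieces of the union
   correspond to disjoint and exhaustive conditions on these four numbers. *)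

(** * Parts, partial sums and tuples *)

Lemma psum0 (a : seq nat) : psum a 0 = 0.
Proof. by rewrite /psum big_geq. Qed.

Lemma psumS (a : seq nat) j : psum a j.+1 = psum a j + part a j.+1.
Proof. by rewrite /psum big_nat_recr. Qed.

Lemma psum_sumn n (t : n.-tuple nat) : psum t n = sumn t.
Proof.
rewrite /psum big_add1 sumnE [RHS](big_nth 0) size_tuple /=.
by [].
Qed.

Lemma part_default n (t : n.-tuple nat) i : n < i -> part t i = 0.
Proof. by case: i => // i lt_ni; rewrite /part nth_default ?size_tuple. Qed.

Lemma part_mktuple n (g : nat -> nat) i :
  0 < i <= n -> part [tuple g k.+1 | k < n] i = g i.
Proof.
case: i => // i lt_in; rewrite /part /=.
by rewrite (nth_map (Ordinal lt_in)) ?size_enum_ord // nth_enum_ord.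
Qed.

Lemma part_tuple_inj n (s t : n.-tuple nat) :
  (forall i, 0 < i -> part s i = part t i) -> s = t.
Proof.
move=> st; apply/val_inj/(@eq_from_nth _ 0); first by rewrite !size_tuple.
by move=> i _; apply: (st i.+1).
Qed.

Lemma eq_psum (s : seq nat) (g : nat -> nat) j :
  (forall i, 0 < i <= j -> part s i = g i) -> psum s j = \sum_(1 <= i < j.+1) g i.
Proof. by move=> sg; apply: eq_big_nat => i ij; apply: sg. Qed.

Lemma sum_eq_index n m : 0 < m <= n -> \sum_(1 <= i < n.+1) (i == m : nat) = 1.
Proof.
move=> mn; rewrite (bigD1_seq m) ?iota_uniq ?mem_index_iota //= eqxx big1 //.
by move=> i /negPf ->.
Qed.

Lemma antitone_fun (g : nat -> nat) :
  (forall i, 0 < i -> g i.+1 <= g i) -> forall i j, 0 < i <= j -> g j <= g i.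
Proof.
move=> g_anti i j /andP[i0 ij]; elim: j ij => [|j IHj]; first by case: i i0.
rewrite leq_eqVlt => /orP[/eqP <- //|ij].
by apply: leq_trans (IHj ij); apply: g_anti; lia.
Qed.

Lemma sorted_part (s : seq nat) :
  sorted geq s -> forall i j, 0 < i <= j -> part s j <= part s i.
Proof.
move=> s_sorted; apply: antitone_fun => -[//|i] _; rewrite /part /=.
have [lt_i|?] := ltnP i.+1 (size s); last by rewrite nth_default.
exact: (sortedP 0 s_sorted).
Qed.

(** * Covers in the dominance order, and the slides that produce them *)

Section Intpart.
Context {n : nat}.
Implicit Types a b : intpart n.

Lemma part_anti a i j : 0 < i <= j -> part a j <= part a i.
Proof. by case/andP: (valP a) => a_sorted _; apply: sorted_part. Qed.

Lemma psum_n a : psum a n = n.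
Proof. by rewrite psum_sumn; case/andP: (valP a) => _ /eqP. Qed.

Lemma psum_ge a j : n <= j -> psum a j = n.
Proof.
elim: j => [|j IHj] le_nj; first by rewrite psum0; lia.
have [eq_nj|lt_nj] : n = j.+1 \/ n <= j by lia.
  by rewrite -eq_nj psum_n.
by rewrite psumS IHj // part_default ?addn0.
Qed.

Lemma intpart_ext a b : (forall i, 0 < i -> part a i = part b i) -> a = b.
Proof. by move=> ab; apply/val_inj/part_tuple_inj. Qed.

Lemma intpartP (t : n.-tuple nat) :
  (forall i, 0 < i -> part t i.+1 <= part t i) -> sumn t = n ->
  exists a : intpart n, pval a = t.
Proof.
move=> t_anti t_sum.
suff tP : is_part n t by exists (IntPart tP).
rewrite /is_part t_sum eqxx andbT; apply/(sortedP 0) => i _.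
exact: (t_anti i.+1).
Qed.

Lemma intpart_of (g : nat -> nat) :
  (forall i, 0 < i -> g i.+1 <= g i) -> (forall i, n < i -> g i = 0) ->
  \sum_(1 <= i < n.+1) g i = n ->
  exists a : intpart n, forall i, 0 < i -> part a i = g i.
Proof.
move=> g_anti g0 g_sum; pose t := [tuple g k.+1 | k < n].
have tE i : 0 < i -> part t i = g i.
  move=> i0; have [le_in|lt_ni] := leqP i n; first by rewrite part_mktuple ?i0.
  by rewrite part_default // g0.
have [||a at_] := @intpartP t.
- by move=> i i0; rewrite !tE // g_anti.
- by rewrite -psum_sumn -[RHS]g_sum; apply: eq_psum => i /andP[i0 _]; apply: tE.
- by exists a => i i0; rewrite at_ tE.
Qed.

Lemma le_domP a b : reflect (forall j, psum a j <= psum b j) (a <= b)%O.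
Proof.
apply: (iffP (asboolP _)) => [ab [|j]|//]; first by rewrite !psum0.
exact: ab.
Qed.

(* The minimal intervals [j, k] with a_j - a_(k+1) >= 2: a cliff at j = k, or
   a slippery step at j whose next descent is at k. *)
Definition slide (s : seq nat) j k :=
  [&& 0 < j, j <= k, part s k.+1 + 2 <= part s j, part s j <= part s k + 1
    & part s j.+1 <= part s k.+1 + 1].

Lemma exists_slide a s t :
  0 < s <= t -> part a t.+1 + 2 <= part a s ->
  exists j k, [/\ slide a j k, s <= j & k <= t].
Proof.
have [m] := ubnP (t - s); elim: m s t => // m IHm s t le_m st gap.
have [gap1|?] := leqP (part a t + 2) (part a s).
  have lt_st : s < t by case: (ltngtP s t) gap1 st => [//|?|->]; lia.
  have [|||j [k [jk sj kt]]] := IHm s t.-1; try by rewrite ?prednK; lia.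
  by exists j, k; split=> //; lia.
have [gap2|?] := leqP (part a t.+1 + 2) (part a s.+1).
  have lt_st : s < t by case: (ltngtP s t) gap2 st => [//|?|->]; lia.
  have [|||j [k [jk sj kt]]] := IHm s.+1 t; try lia.
  by exists j, k; split=> //; lia.
by exists s, t; split=> //; rewrite /slide; lia.
Qed.

(** By monotonicity, a strictly inner gap of 2 would contradict the minimality of the outer
    interval. *)
Lemma slide_nested a j k j' k' :
  slide a j k -> slide a j' k' -> j <= j' -> k' <= k -> j = j' /\ k = k'.
Proof.
move=> /and5P[j0 jk ? h1 h2] /and5P[j0' jk' gap ? ?] le_j le_k; split; apply/eqP.
  have [lt_j|?] := ltnP j j'; last by lia.
  have := @part_anti a j.+1 j'; have := @part_anti a k'.+1 k.+1; lia.
have [lt_k|?] := ltnP k' k; last by lia.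
have := @part_anti a k'.+1 k; have := @part_anti a j j'; lia.
Qed.

(* One unit moves from part [j] to part [k + 1] (written without subtraction). *)
Definition slid a j k b :=
  forall i, 0 < i -> part b i + (i == j) = part a i + (i == k.+1).

Lemma slid_psum a j k b i :
  0 < j <= k -> slid a j k b -> psum b i + (j <= i <= k) = psum a i.
Proof.
move=> jk ab; elim: i => [|i IHi]; first by rewrite !psum0; lia.
by have := ab i.+1 isT; rewrite !psumS; lia.
Qed.

(** Guarantees that the receiving row [k + 1] exists in an [n]-tuple. If [n <= k], the first [n]
    parts are all positive and part [j] is at least 2, so they sum to more than [n]. *)
Lemma slide_bound a j k : slide a j k -> k < n.
Proof.
move=> /and5P[j0 jk gap h1 h2]; rewrite ltnNge; apply/negP => le_nk.
have pos i : 0 < i <= n -> 0 < part a i.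
  move=> lein; have := @part_anti a i k; lia.
have le_psum i : i <= n -> i <= psum a i /\ (2 <= part a j -> j <= i -> i < psum a i).
  elim: i => [|i IHi] lein; first by split=> //; lia.
  have := pos i.+1 lein; have [] := IHi (ltnW lein); rewrite psumS.
  have [->|] := eqVneq j i.+1; lia.
have := le_psum n (leqnn n); rewrite psum_n.
have [le_jn|lt_nj] := leqP j n; first lia.
by have := part_default (pval a) lt_nj; lia.
Qed.

Lemma slide_slid a j k : slide a j k -> exists b, slid a j k b.
Proof.
move=> sl; have lt_kn := slide_bound sl; move: sl => /and5P[j0 jk gap h1 h2].
pose g i := part a i - (i == j) + (i == k.+1).
have gE i : 0 < i -> g i + (i == j) = part a i + (i == k.+1).
  by rewrite /g; case: eqVneq => [->|]; lia.
have [|||b bE] := @intpart_of g.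
(* Rows [j] and [k] are strict descents, of size at least 2 if they coincide, so [g] stays weakly
   decreasing. *)
- move=> i i0; rewrite /g; have := @part_anti a i i.+1.
  case: (eqVneq i j) => [ij|]; case: (eqVneq i k) => [ik|];
    case: (eqVneq i.+1 j) => [ij1|]; case: (eqVneq i k.+1) => [ik1|]; subst; try lia.
- by move=> i lt_ni; rewrite /g part_default; lia.
- have E := psum_n a; rewrite /psum in E.
  have : \sum_(1 <= i < n.+1) (g i + (i == j)) =
         \sum_(1 <= i < n.+1) (part a i + (i == k.+1)).
    by apply: eq_big_nat => i /andP[i0 _]; apply: gE.
  rewrite !big_split /= E.
  rewrite !sum_eq_index; lia.
- by exists b => i i0; rewrite bE ?gE.
Qed.

(** Let [s] be the first row where the partial sums differ and [t + 1] the first later row where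
    they agree again. Then [a_s > b_s >= b_(t+1) > a_(t+1)], a gap of 2 that contains a slide. *)
Lemma lt_slide a b : (b < a)%O ->
  exists j k, slide a j k /\ forall i, j <= i <= k -> psum b i < psum a i.
Proof.
rewrite lt_neqAle => /andP[neq_ba /le_domP le_ba].
have ex_s : exists i, psum b i < psum a i.
  apply: contrapT => no; case/negP: neq_ba; apply/eqP/le_anti/andP; split.
    exact/le_domP.
  by apply/le_domP => i; rewrite leqNgt; apply/negP => lt_i; apply: no; exists i.
case: (ex_minnP ex_s) => s lt_s min_s.
have ex_t : exists t, (s <= t) && (psum a t.+1 <= psum b t.+1).
  (* From row [n] on, both partial sums equal [n]. *)
  by exists (maxn s n); rewrite !psum_ge ?leq_maxl //; lia.
case: (ex_minnP ex_t) => t /andP[st le_t] min_t.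
have lt_in i : s <= i <= t -> psum b i < psum a i.
  move=> /andP[si it]; case: (eqVneq s i) => [<- //|ne_si].
  rewrite ltnNge; apply/negP => le_i; have := min_t i.-1.
  by rewrite prednK ?le_i; lia.
have s0 : 0 < s by case: s lt_s {min_s ex_t st min_t lt_in} => //; rewrite !psum0.
have as_ : part b s < part a s.
  case: s s0 lt_s min_s {ex_t st min_t lt_in} => // s _ + /(_ s).
  by rewrite !psumS; have := le_ba s; lia.
have at_ : part a t.+1 < part b t.+1.
  by move: le_t; rewrite !psumS; have := lt_in t; lia.
have [||j [k [sl sj kt]]] := @exists_slide a s t; first lia.
  by have := @part_anti b s t.+1; lia.
by exists j, k; split=> // i ijk; apply: lt_in; lia.
Qed.

Lemma coversP a b :
  covers a b <-> exists j k, slide a j k /\ slid a j k b.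
Proof.
have slid_lt j k c : slide a j k -> slid a j k c -> (c < a)%O.
  move=> /and5P[j0 jk _ _ _] ac; have jk0 : 0 < j <= k by lia.
  have E i := slid_psum i jk0 ac.
  rewrite lt_neqAle; apply/andP; split; last first.
    by apply/le_domP => i; have := E i; lia.
  by apply/eqP => ca; have := E j; rewrite ca; lia.
split=> [[lt_ba no_mid]|[j [k [sl ab]]]].
  have [j [k [sl lt_jk]]] := lt_slide lt_ba.
  (* The slide lowers the sums of [a] by one, only where those of [b] are already smaller, so
     [b <= c < a] and the cover forces [b = c]. *)
  have [c ac] := slide_slid sl; exists j, k; split=> //.
  suff -> : b = c by [].
  apply: contrapT => /eqP neq_bc; apply: no_mid; exists c.
  rewrite (slid_lt _ _ _ sl ac) andbT lt_neqAle neq_bc /=.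
  have jk : 0 < j <= k by case/and5P: sl => *; lia.
  apply/le_domP => i; have := slid_psum i jk ac; have := lt_jk i.
  by have /le_domP/(_ i) := ltW lt_ba; lia.
split=> [|[c /andP[lt_bc lt_ca]]]; first exact: slid_lt sl ab.
have [j' [k' [sl' lt_jk']]] := lt_slide lt_ca.
have jk : 0 < j <= k by case/and5P: sl => *; lia.
have jk' : 0 < j' <= k' by case/and5P: sl' => *; lia.
have /le_domP le_bc := ltW lt_bc.
(* The sums of [b] and [a] differ only on [[j, k]], so a slide found below [a] and above [b] is
   nested in this one and hence equal to it; then [c] already lies below [b]. *)
have in_jk i : j' <= i <= k' -> j <= i <= k.
  by move=> /lt_jk'; have := slid_psum i jk ab; have := le_bc i; lia.
have [||ej ek] := slide_nested sl sl'.
- by have := in_jk j'; lia.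
- by have := in_jk k'; lia.
subst j' k'.
suff le_cb : (c <= b)%O by have := lt_le_trans lt_bc le_cb; rewrite ltxx.
apply/le_domP => i; have := slid_psum i jk ab; have := lt_jk' i.
by have /le_domP/(_ i) := ltW lt_ca; lia.
Qed.

Lemma J_slideP a : J n a <->
  exists j k, slide a j k /\ forall j' k', slide a j' k' -> j' = j /\ k' = k.
Proof.
split=> [[b [/coversP[j [k [sl ab]]] uniq_b]]|[j [k [sl uniq_jk]]]].
  exists j, k; split=> // j' k' sl'; have [b' ab'] := slide_slid sl'.
  have {uniq_b} eq_b : b = b' by apply: uniq_b; apply/coversP; exists j', k'.
  subst b'; case/and5P: sl sl' => j0 jk _ _ _ /and5P[j0' jk' _ _ _].
  (* Two slides with the same result coincide: the row that loses a unit and the row that gains one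
     are both determined. *)
  have E i : 0 < i -> (i == j) + (i == k'.+1) = (i == j') + (i == k.+1).
    by move=> i0; have := ab i i0; have := ab' i i0; lia.
  have := E j j0; have := E j' j0'; have := E k.+1 isT; have := E k'.+1 isT; lia.
have [b ab] := slide_slid sl; exists b; split.
  by apply/coversP; exists j, k.
move=> b' /coversP[j' [k' [sl' ab']]]; have [? ?] := uniq_jk _ _ sl'; subst.
by apply: intpart_ext => i i0; have := ab i i0; have := ab' i i0; lia.
Qed.

End Intpart.

(** * Column coordinates of the join-irreducible partitions *)

Lemma down_pred (P : pred nat) m :
  (forall i, 0 < i -> P i.+1 -> P i) -> ~~ P m.+1 ->
  exists p, p <= m /\ forall i, 0 < i -> P i = (i <= p).
Proof.
move=> P_down Pm; have ex_p : exists p, ~~ P p.+1 by exists m.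
case: (ex_minnP ex_p) => p Pp min_p; exists p; split=> [|i i0]; first exact: min_p.
have [le_ip|] := leqP i p.
  apply/negPn/negP => Pi; have := min_p i.-1.
  by rewrite prednK // => /(_ Pi); lia.
elim: i {i0} => // i IHi; rewrite ltnS leq_eqVlt => /orP[/eqP <-|lt_pi].
  exact/negbTE.
by apply/negP => /P_down; rewrite IHi //; lia.
Qed.

(* The partition whose Young diagram has [c] columns of length [q], and one
   column of length [p] and one of length [r] (length 0 meaning no column). *)
Definition cols p q c r i := (i <= p) + (if i <= q then c else 0) + (i <= r).

(** Two columns of distinct lengths are always filed with the longer one as [q], which makes the
    coordinates unique. Three single columns of distinct lengths would admit two slides, and a lone
    column none. *)
Definition irr_cols p q c r :=
  [&& p < q, (r == 0) || (q < r) & (1 < c) || [&& c == 1, 0 < p & r == 0]].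

Definition has_cols (s : seq nat) p q c r :=
  irr_cols p q c r /\ forall i, 0 < i -> part s i = cols p q c r i.

Lemma colsP p q c r i :
  (i <= q -> cols p q c r i = (i <= p) + c + (i <= r)) /\
  (q < i -> cols p q c r i = (i <= p) + (i <= r)).
Proof. by rewrite /cols; case: leqP; rewrite ?addn0. Qed.

Lemma cols_anti p q c r i : cols p q c r i.+1 <= cols p q c r i.
Proof. have := colsP p q c r i; have := colsP p q c r i.+1; lia. Qed.

Section HasCols.
Variables (s : seq nat) (p q c r : nat).
Hypothesis s_cols : has_cols s p q c r.

Lemma has_cols_le i : 0 < i <= q -> part s i = (i <= p) + c + (0 < r).
Proof.
case: s_cols => /and3P[p_q r_q cpr] sE /andP[i0 iq].
by rewrite sE // /cols iq; lia.
Qed.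

Lemma has_cols_gt i : q < i -> part s i = (i <= r).
Proof.
case: s_cols => /and3P[p_q r_q cpr] sE qi.
rewrite sE /cols; last by lia.
by rewrite [i <= q]leqNgt qi /=; lia.
Qed.

(** Rows up to [q] differ by at most 1, so no slide ends before [q]. One ending after [q] would need
    [r > 0] and a part equal to 2 in a row up to [q], but then [c >= 2] makes those parts at least
    3. With [k = q], the start is [q] if [c] is a cliff and [p] otherwise. *)
Lemma slide_has_cols j k :
  slide s j k <-> j = (if 1 < c then q else p) /\ k = q.
Proof.
case: s_cols => /and3P[p_q r_q cpr] _.
split=> [/and5P[j0 jk]|[-> ->]].
  case: (ltngtP k q) => kq.
  - by rewrite !has_cols_le; lia.
  - rewrite (has_cols_gt (i := k)) ?(has_cols_gt (i := k.+1)); [|lia|lia].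
    have [jq|jq] := leqP j q; first by rewrite (has_cols_le (i := j)); lia.
    by rewrite (has_cols_gt (i := j)); lia.
  - rewrite kq (has_cols_gt (i := q.+1)) // !(has_cols_le (i := j)); [|lia].
    rewrite (has_cols_le (i := q)); [|lia].
    have [jq|jq] := ltnP j q.
      by rewrite (has_cols_le (i := j.+1)); case: (ltnP 1 c); lia.
    have -> : j = q by lia.
    by rewrite (has_cols_gt (i := q.+1)) //; case: (ltnP 1 c); lia.
case: (ltnP 1 c) => c1; rewrite /slide (has_cols_gt (i := q.+1)) //.
  by rewrite !has_cols_le; lia.
by rewrite !has_cols_le; lia.
Qed.

End HasCols.

(** The end of the unique slide recovers [q]; row [q + 1] tells whether [r > 0], row [q] then gives
    [c], and comparing the remaining rows gives [p] and [r]. *)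
Lemma has_cols_inj s p q c r p' q' c' r' :
  has_cols s p q c r -> has_cols s p' q' c' r' ->
  [/\ p = p', q = q', c = c' & r = r'].
Proof.
move=> h h'; have [] : (if 1 < c then q else p) = (if 1 < c' then q' else p') /\ q = q'.
  by apply/(slide_has_cols h')/(slide_has_cols h).
case: (h) (h') => /and3P[p_q r_q cpr] _ [/and3P[p_q' r_q' cpr'] _] + eq_q; subst q'.
have le i iq : _ = _ := etrans (esym (has_cols_le h (i := i) iq)) (has_cols_le h' iq).
have gt i iq : _ = _ := etrans (esym (has_cols_gt h (i := i) iq)) (has_cols_gt h' iq).
have eq_r0 : (0 < r) = (0 < r') by have := gt q.+1 (leqnn _); clear le gt; lia.
have eq_c : c = c' by have := le q; clear le gt; lia.
split=> //; apply/eqP.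
  by have := le p; have := le p'; clear le gt cpr cpr'; lia.
by have := gt r; have := gt r'; clear le gt cpr cpr'; lia.
Qed.

Lemma J_cols n (a : intpart n) :
  J n a <-> exists p q c r, has_cols a p q c r.
Proof.
split=> [/J_slideP[j [k [sl uniq_jk]]]|[p [q [c [r [irr aE]]]]]].
  have [j0 jk gap h1 h2] := and5P sl.
  (* A larger part would produce a second slide, ending before [k]. *)
  have before i : 0 < i < k -> part a i <= part a k + 1.
    move=> ik; rewrite leqNgt; apply/negP => ?.
    have [||j' [k' [/uniq_jk[_ ->]]]] := @exists_slide _ a i k.-1; try lia.
    by rewrite prednK; lia.
  (* A larger part would produce a second slide, starting after [j]; the gap is taken against a row
     beyond [n], whose part is 0. *)
  have after i : j < i -> part a i <= 1.
    move=> ji; rewrite leqNgt; apply/negP => ?.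
    have [||j' [k' [/uniq_jk[-> _]]]] := @exists_slide _ a i (maxn i n); try lia.
    by rewrite [part a (maxn i n).+1]part_default; lia.
  have [p [le_pk pE]] : exists p, p <= k.-1 /\
      forall i, 0 < i -> (part a k < part a i) = (i <= p).
    apply: down_pred => [i i0|]; last by rewrite prednK ?ltnn //; lia.
    by have := @part_anti _ a i i.+1; lia.
  have [r [le_rn rE]] : exists r, r <= n /\
      forall i, 0 < i -> (0 < part a i) = (i <= r).
    apply: down_pred => [i i0|]; last by rewrite part_default.
    by have := @part_anti _ a i i.+1; lia.
  (* The first column has length [r]. If it does not pass row [k], it is one of the columns of
     length [q = k] and there is no longer one. *)
  pose r' := if r <= k then 0 else r.
  exists p, k, (part a k - (k < r)), r'.
  have rk := rE k.+1 isT; have ak := after k.+1.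
  have pk := pE k ltac:(lia); have pj := pE j ltac:(lia).
  have rk' := rE k ltac:(lia); have aj := after k.
  split=> [|i i0]; first by rewrite /irr_cols /r'; case: (leqP r k) => rk0; lia.
  have := pE i i0; have := rE i i0; rewrite /cols /r'.
  have [ik|ki] := leqP i k; last by have := after i; case: (leqP r k); lia.
  by have := before i; have := @part_anti _ a i k; case: (leqP r k); lia.
apply/J_slideP; exists (if 1 < c then q else p), q.
have h : has_cols a p q c r by [].
by split=> [|j k]; [apply/(slide_has_cols h)|move/(slide_has_cols h)].
Qed.

(** * The arrows in column coordinates *)

Section Darrow.
Variables (n m : nat).
Hypothesis m_bound : 0 < m <= n.+1.

Lemma part_darrow (a : intpart n) i :
  0 < i -> part (darrow m a) i = part a i + (i == m).
Proof.
move=> i0; have [le_in|lt_ni] := leqP i n.+1.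
  by rewrite (part_mktuple (fun k => part a k + (k == m))) ?i0.
by rewrite !part_default //; lia.
Qed.

Lemma sumn_darrow (a : intpart n) : sumn (darrow m a) = n.+1.
Proof.
rewrite -psum_sumn (@eq_psum _ (fun i => part a i + (i == m))); last first.
  by move=> i /andP[i0 _]; apply: part_darrow.
by rewrite big_split (sum_eq_index m_bound) -/(psum a n.+1) psum_ge //= addn1.
Qed.

Lemma darrow_surj (t : n.+1.-tuple nat) (g : nat -> nat) :
  sumn t = n.+1 -> (forall i, 0 < i -> g i.+1 <= g i) ->
  (forall i, 0 < i -> part t i = g i + (i == m)) ->
  exists2 a : intpart n, darrow m a = t & forall i, 0 < i -> part a i = g i.
Proof.
move=> t_sum g_anti tE.
have g_sum : \sum_(1 <= i < n.+2) g i = n.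
  have : psum t n.+1 = n.+1 by rewrite psum_sumn.
  rewrite (@eq_psum _ (fun i => g i + (i == m))) => [|i /andP[i0 _]]; last exact: tE.
  by rewrite big_split (sum_eq_index m_bound) /= addn1 => -[].
(* Otherwise all [n + 1] values would be positive, while they sum to [n]. *)
have g0 : g n.+1 = 0.
  apply/eqP; rewrite -leqn0 leqNgt; apply/negP => g_pos.
  suff : n.+1 <= \sum_(1 <= i < n.+2) g i by rewrite g_sum ltnn.
  have {1}-> : n.+1 = \sum_(1 <= i < n.+2) 1 by rewrite sum_nat_const_nat; lia.
  rewrite !big_add1 !big_mkord /=; apply: leq_sum => i _.
  by apply: leq_trans g_pos _; apply: antitone_fun => //; have := ltn_ord i; lia.
have [||a aE] := @intpart_of n g g_anti.
- by move=> i lt_ni; have := antitone_fun g_anti (i := n.+1) (j := i); lia.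
- by move: g_sum; rewrite big_nat_recr //= g0 addn0.
exists a => //; apply: part_tuple_inj => i i0.
by rewrite part_darrow // aE // tE.
Qed.

(** Reduces the image of a piece to arithmetic: [K] describes [C] before the arrow and [K'] the
    result. The coordinates are re-chosen after the arrow because the lengthened column may change
    its role. *)
Lemma image_darrow (C : set (intpart n)) (K K' : nat -> nat -> nat -> nat -> Prop) :
  (forall (a : intpart n) p q c r, has_cols a p q c r -> C a <-> K p q c r) ->
  (forall p q c r, irr_cols p q c r -> K p q c r -> exists p' q' c' r',
     [/\ irr_cols p' q' c' r', K' p' q' c' r' &
         forall i, 0 < i -> cols p' q' c' r' i = cols p q c r i + (i == m)]) ->
  (forall p' q' c' r', irr_cols p' q' c' r' -> K' p' q' c' r' -> exists p q c r,
     [/\ irr_cols p q c r, K p q c r &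
         forall i, 0 < i -> cols p' q' c' r' i = cols p q c r i + (i == m)]) ->
  forall t, (darrow m @` (J n `&` C)) t <->
    sumn t = n.+1 /\ exists p q c r, has_cols t p q c r /\ K' p q c r.
Proof.
move=> CK KK' K'K t; split=> [[a [/J_cols[p [q [c [r h]]]]]]|].
  move=> /(CK _ _ _ _ _ h) Kp <-; split; first exact: sumn_darrow.
  case: h => irr aE; have [p' [q' [c' [r' [irr' Kp' E]]]]] := KK' _ _ _ _ irr Kp.
  exists p', q', c', r'; split=> //; split=> // i i0.
  by rewrite part_darrow // aE // E.
move=> [t_sum [p' [q' [c' [r' [[irr' tE] Kp']]]]]].
have [p [q [c [r [irr Kp E]]]]] := K'K _ _ _ _ irr' Kp'.
have [||a at_ aE] := @darrow_surj t (cols p q c r) t_sum.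
- by move=> i _; apply: cols_anti.
- by move=> i i0; rewrite tE // E.
have h : has_cols a p q c r by [].
exists a => //; split; last exact/(CK _ _ _ _ _ h).
by apply/J_cols; exists p, q, c, r.
Qed.

End Darrow.

Lemma image_J n (t : n.-tuple nat) :
  (pval (n := n) @` J n) t <->
  sumn t = n /\ exists p q c r, has_cols t p q c r.
Proof.
split=> [[a /J_cols[p [q [c [r h]]]] <-]|[t_sum [p [q [c [r [irr tE]]]]]]].
  by split; [case/andP: (valP a) => _ /eqP|exists p, q, c, r].
have [||a at_] := @intpartP n t; first by move=> i i0; rewrite !tE //; apply: cols_anti.
  by [].
by exists a => //; apply/J_cols; exists p, q, c, r; rewrite at_.
Qed.

(** * Cliffs, plateaus and steps at 1: [d s i] counts the columns of length [i] *)

Lemma d_cols s p q c r i : has_cols s p q c r -> 0 < i ->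
  d s i = (i == p) + (if i == q then c else 0) + (i == r).
Proof.
move=> [_ sE] i0; rewrite /d !sE // /cols.
by case: (ltngtP i q) => ?; lia.
Qed.

Lemma cliff_cols s p q c r :
  has_cols s p q c r -> cliff s 1 <-> p = 0 /\ q = 1.
Proof.
move=> h; have [/and3P[p_q r_q cpr] _] := h; rewrite /cliff (d_cols h) //.
by case: (eqVneq 1 q); lia.
Qed.

Lemma non_slippery_plateau_cols s p q c r :
  has_cols s p q c r -> non_slippery_plateau s 1 <-> p = 0 /\ 1 < q.
Proof.
move=> h; have [/and3P[p_q r_q cpr] _] := h; split=> [[k [k1 d0]]|[p0 q1]].
  rewrite /cliff (d_cols h); last lia.
  case: (eqVneq k q) => [eq_k _|]; last by lia.
  split; last by lia.
  apply/eqP; rewrite -leqn0 leqNgt; apply/negP => p_pos.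
  by have := d0 p; rewrite (d_cols h) // eqxx; lia.
exists q; split=> // [i iq|]; rewrite /cliff (d_cols h) ?eqxx; try lia.
by case: (eqVneq i q); lia.
Qed.

(** A plateau from row 1 ends at the shortest column. A drop of exactly 1 there means that this
    column is [p], since [c = 1] already requires a shorter one. *)
Lemma slippery_plateau_cols s p q c r l : 0 < l ->
  has_cols s p q c r -> slippery_plateau_of_length l s 1 <-> p = l.+1.
Proof.
move=> l0 h; have [/and3P[p_q r_q cpr] _] := h; split=> [[k [k1 kl d0]]|pl].
  rewrite (d_cols h); last lia.
  have dq := d0 q; have dp := d0 p.
  have {}dq : k <= q.
    rewrite leqNgt; apply/negP => ?.
    by have := dq ltac:(lia); rewrite (d_cols h) ?eqxx; lia.
  have {}dp : 0 < p -> k <= p.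
    move=> p0; rewrite leqNgt; apply/negP => ?.
    by have := dp ltac:(lia); rewrite (d_cols h) ?eqxx; lia.
  by case: (eqVneq k q); lia.
exists p; split; [lia|lia|move=> i ip|]; rewrite (d_cols h); try lia.
- by case: (eqVneq i q); lia.
- by case: (eqVneq p q); lia.
Qed.

Lemma part_decr1 s i : 0 < i -> part (decr s 1) i = part s i - (i == 1).
Proof.
by case: i => [//|[|i]] _; rewrite /decr /part nth_set_nth /= ?subn1 ?subn0.
Qed.

Lemma d_decr1 s i : 0 < i -> d (decr s 1) i = d s i - (i == 1).
Proof. by move=> i0; rewrite /d !part_decr1 //; lia. Qed.

Lemma is_part_decr1 n (a : intpart n) :
  0 < part a 1 /\ is_part n.-1 (decr a 1) <-> 0 < d a 1.
Proof.
split=> [[a1 /andP[b_sorted _]]|a1].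
  by have := sorted_part b_sorted (i := 1) (j := 2) isT; rewrite !part_decr1 // /d; lia.
have a1_pos : 0 < part a 1 by move: a1; rewrite /d; lia.
split=> //; move: a1 a1_pos; case/andP: (valP a).
case: (tval (pval a)) => [//|x s] /= x_sorted /eqP sumE.
rewrite /d /decr /part /= => a1 x0.
rewrite /is_part /=; apply/andP; split; last by lia.
by case: s x_sorted a1 {sumE} => //= y s /andP[_ ->]; lia.
Qed.

(** Shared by both kinds of step. Row 1 must have had a drop of exactly 1, so the removed box was
    the whole column [p]; the plateau then ends at the next shortest length [q], where the drop is
    [c]. *)
Lemma decr1_plateau_cols n (a : intpart n) p q c r k :
  has_cols a p q c r -> 0 < d a 1 -> 1 < k ->
  (forall i, 1 <= i < k -> d (decr a 1) i = 0) -> 0 < d (decr a 1) k ->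
  p = 1 /\ d (decr a 1) k = c.
Proof.
move=> h + k1 d0; have [/and3P[p_q r_q cpr] _] := h.
have d01 := d0 1; have d0q := d0 q; rewrite !d_decr1 ?(d_cols h) in d01 d0q *; try lia.
rewrite eqxx in d0q.
have p1 : 0 < (1 == p) + (if 1 == q then c else 0) + (1 == r) -> p = 1.
  by clear d0q d0; case: (eqVneq 1 q) d01 => ?; lia.
move=> /p1 {}p1; clear d01 d0; case: (ltngtP k q) => kq; lia.
Qed.

Lemma slippery_step_cols n (a : intpart n) p q c r :
  has_cols a p q c r -> slippery_step a 1 <-> p = 1 /\ c = 1.
Proof.
move=> h; have [/and3P[p_q r_q cpr] _] := h.
split=> [[a1 b_part [l [k [k1 _ d0 dk]]]]|[p1 c1]].
  have := proj1 (is_part_decr1 a) (conj a1 b_part).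
  by move=> /(decr1_plateau_cols h)/(_ k1 d0); case=> [|-> <-]; rewrite ?dk.
have [] := proj2 (is_part_decr1 a); first by rewrite (d_cols h) // p1.
move=> a1 b_part; split=> //; exists q.-1, q; split=> [||i iq|]; try lia.
  by rewrite d_decr1 ?(d_cols h); try lia; case: (eqVneq i q); lia.
by rewrite d_decr1 ?(d_cols h) ?eqxx; lia.
Qed.

Lemma non_slippery_step_cols n (a : intpart n) p q c r :
  has_cols a p q c r -> non_slippery_step a 1 <-> p = 1 /\ 1 < c.
Proof.
move=> h; have [/and3P[p_q r_q cpr] _] := h.
split=> [[a1 b_part [k [k1 d0 dk]]]|[p1 c1]].
  have := proj1 (is_part_decr1 a) (conj a1 b_part).
  by move=> /(decr1_plateau_cols h)/(_ k1 d0); case=> [|-> <-] //; apply: ltnW.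
have [] := proj2 (is_part_decr1 a); first by rewrite (d_cols h) // p1.
move=> a1 b_part; split=> //; exists q; split=> [|i iq|]; try lia.
  by rewrite d_decr1 ?(d_cols h); try lia; case: (eqVneq i q); lia.
by rewrite /cliff d_decr1 ?(d_cols h) ?eqxx; lia.
Qed.

(** * The arrow pieces as conditions on the coordinates *)

Lemma image_darrow_first n (t : n.+1.-tuple nat) : 0 < n ->
  (darrow 1 @` (J n `&` Cl n)) t <->
  sumn t = n.+1 /\ exists p q c r,
    has_cols t p q c r /\ [&& p == 0, q == 1 & 2 < c].
Proof.
move=> n0; apply: (image_darrow _ (K := fun p q c r => p = 0 /\ q = 1)) => //.
- by move=> a p q c r; apply: cliff_cols.
(* The new box is one more column of length 1; since [p = 0] forces [c >= 2], the new multiplicity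
   exceeds 2. *)
- move=> p q c r irr [p0 q1]; subst p q; exists 0, 1, c.+1, r.
  rewrite /irr_cols /cols in irr *.
  by split=> [||i i0]; try lia; case: (leqP i 1); lia.
- move=> p q c r irr /and3P[/eqP p0 /eqP q1 c2]; subst p q; exists 0, 1, c.-1, r.
  rewrite /irr_cols /cols in irr *.
  by split=> [||i i0]; try lia; case: (leqP i 1); lia.
Qed.

Lemma image_darrow_plateau n (t : n.+1.-tuple nat) :
  (darrow 1 @` (J n `&` NP n)) t <->
  sumn t = n.+1 /\ exists p q c r, has_cols t p q c r /\ (p == 1) && (1 < c).
Proof.
apply: (image_darrow _ (K := fun p q c r => p = 0 /\ 1 < q)) => //.
- by move=> a p q c r; apply: non_slippery_plateau_cols.
- move=> p q c r irr [p0 q1]; subst p; exists 1, q, c, r.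
  rewrite /irr_cols /cols in irr *.
  by split=> [||i i0]; try lia; case: (leqP i q); lia.
- move=> p q c r irr /andP[/eqP p1 c2]; subst p; exists 0, q, c, r.
  rewrite /irr_cols /cols in irr *.
  by split=> [||i i0]; try lia; case: (leqP i q); lia.
Qed.

(* A column of length [l + 1] grown to length [l + 2] either stays shorter than
   the repeated column or becomes one more copy of it. *)
Definition grown l (cc : pred nat) p q c r :=
  (p == l.+2) && cc c || [&& p == 0, q == l.+2, cc c.-1 & (c == 2) ==> (r == 0)].

(** Serves three families: slippery steps ([l = 0], [c = 1]), non-slippery steps ([l = 0], [c >= 2])
    and slippery plateaus ([l >= 1], any [c]). *)
Lemma image_darrow_grown n l (C : set (intpart n)) (cc : pred nat)
    (t : n.+1.-tuple nat) : l < n ->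
  (forall (a : intpart n) p q c r,
     has_cols a p q c r -> C a <-> p = l.+1 /\ cc c) ->
  (darrow l.+2 @` (J n `&` C)) t <->
  sumn t = n.+1 /\ exists p q c r, has_cols t p q c r /\ grown l cc p q c r.
Proof.
move=> ln CK; apply: (image_darrow _ (K := fun p q c r => p = l.+1 /\ cc c)) => //.
- move=> p q c r /and3P[pq rq cpr] [pl ccc]; subst p.
  have [eq_q|ne_q] := eqVneq q l.+2.
    exists 0, q, c.+1, r; rewrite /grown /irr_cols /cols /= ccc.
    by split=> [||i i0]; try lia; case: (leqP i q); lia.
  exists l.+2, q, c, r; rewrite /grown /irr_cols /cols ccc.
  by split=> [||i i0]; try lia; case: (leqP i q); lia.
- move=> p q c r /and3P[pq rq cpr].
  case/orP=> [/andP[/eqP pl ccc]|/and4P[/eqP p0 /eqP ql ccc c2]].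
    exists l.+1, q, c, r; rewrite /irr_cols /cols.
    by split=> [||i i0]; try lia; case: (leqP i q); lia.
  (* One of the [c] columns is shortened back. If a single one remains, irreducibility needs
     [r = 0], hence the last clause of [grown]. *)
  exists l.+1, q, c.-1, r; rewrite /irr_cols /cols.
  by split=> [||i i0]; try lia; case: (leqP i q); lia.
Qed.

(** * The exceptional families [E1] and [E2] *)

Lemma part_nonzero_parts s : sorted geq s ->
  forall i, part (nonzero_parts s) i = part s i.
Proof.
move=> s_sorted i; rewrite /part; move: i.-1 => {}i.
elim: s s_sorted i => [//|x s IHs] /= x_sorted i.
have s_sorted := path_sorted x_sorted.
have [x0|] := ltnP 0 x; first by case: i => //= i; apply: IHs.
rewrite leqn0 => /eqP x0; subst x; rewrite -/(nonzero_parts s) IHs //.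
have s0 j : nth 0 s j = 0.
  apply/eqP; rewrite -leqn0.
  exact: (@sorted_part (0 :: s) x_sorted 1 j.+2).
by case: i => [|i] /=; rewrite !s0.
Qed.

(** Positivity makes the length visible: the default 0 appears only past the end. *)
Lemma eq_positive_seq (s u : seq nat) :
  all (leq 1) s -> all (leq 1) u -> (forall i, 0 < i -> part s i = part u i) ->
  s = u.
Proof.
elim: s u => [|x s IHs] [|y u] //=.
- by move=> _ /andP[y0 _] /(_ 1 isT); rewrite /part /=; lia.
- by move=> /andP[x0 _] _ /(_ 1 isT); rewrite /part /=; lia.
move=> /andP[_ s0] /andP[_ u0] su; rewrite (su 1 isT : x = y).
by rewrite (IHs u) // => -[//|i] _; apply: (su i.+2).
Qed.

Lemma nonzero_partsP s u : sorted geq s -> all (leq 1) u ->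
  nonzero_parts s = u <-> forall i, 0 < i -> part s i = part u i.
Proof.
move=> s_sorted u0; split=> [<- i _|su]; first by rewrite part_nonzero_parts.
apply: eq_positive_seq => // [|i i0]; first exact: filter_all.
by rewrite part_nonzero_parts // su.
Qed.

Lemma sumn_nonzero_parts s : sumn (nonzero_parts s) = sumn s.
Proof. by elim: s => //= x s <-; case: x. Qed.

Lemma part_two_blocks x y m l i : 0 < i ->
  part (nseq m x ++ nseq l y) i = if i <= m then x else if i <= m + l then y else 0.
Proof.
case: i => // i _; rewrite /part /= nth_cat size_nseq !nth_nseq.
by case: ltnP => // mi; rewrite ltn_subLR.
Qed.

Lemma all_two_blocks x y m l : all (leq 1) (nseq m x.+1 ++ nseq l y.+1).
Proof. by rewrite all_cat !all_nseq !orbT. Qed.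

Lemma has_cols_sorted s p q c r : has_cols s p q c r -> sorted geq s.
Proof.
move=> [_ sE]; apply/(sortedP 0) => i _.
have := cols_anti p q c r i.+1; rewrite -!sE //.
Qed.

Lemma image_E1 n (t : n.-tuple nat) : 2 < n ->
  (pval (n := n) @` E1 n) t <->
  sumn t = n /\ exists p q c r, has_cols t p q c r /\ (p == 1) && (c == 1).
Proof.
move=> n2; have E k : 2 :: nseq k 1 = nseq 1 2 ++ nseq k 1 by [].
split=> [[a]|[t_sum [p [q [c [r [h /andP[/eqP p1 /eqP c1]]]]]]]].
  rewrite /E1 /= E; have [a_sorted /eqP a_sum] := andP (valP a).
  move=> /(nonzero_partsP a_sorted (all_two_blocks 1 0 _ _)) aE <-.
  split=> //; exists 1, n.-1, 1, 0; split=> //.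
  split=> [|i i0]; first by rewrite /irr_cols; lia.
  rewrite aE // part_two_blocks // /cols (_ : 1 + (n - 2) = n.-1); last by lia.
  by case: (leqP i 1); case: (leqP i n.-1); lia.
have [/and3P[pq rq cpr] tE] := h.
have t_sorted := has_cols_sorted h.
have [||a at_] := @intpartP n t => //.
  by move=> i i0; rewrite !tE //; apply: cols_anti.
exists a => //; rewrite /E1 /= at_.
have nz : nonzero_parts t = 2 :: nseq q.-1 1.
  rewrite E; apply/nonzero_partsP => //; first exact: all_two_blocks.
  move=> i i0; rewrite tE // part_two_blocks // /cols p1 c1.
  rewrite (_ : 1 + q.-1 = q); last by lia.
  by case: (leqP i 1); case: (leqP i q); lia.
(* The sum forces [q = n - 1], which fixes the number of ones. *)
have := sumn_nonzero_parts t; rewrite nz t_sum /= sumn_nseq => n_eq.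
by congr (_ :: nseq _ _); lia.
Qed.

Lemma image_E2 n (t : n.-tuple nat) :
  (pval (n := n) @` E2 n) t <->
  sumn t = n /\ exists p q c r,
    has_cols t p q c r /\ [&& p == 0, c == 2 & 0 < r].
Proof.
split=> [[a [m [l [m1 l1]]]]|[t_sum [p [q [c [r [h /and3P[/eqP p0 /eqP c2 r0]]]]]]]].
  have [a_sorted /eqP a_sum] := andP (valP a).
  move=> /(nonzero_partsP a_sorted (all_two_blocks 2 0 _ _)) aE <-.
  split=> //; exists 0, m, 2, (m + l); split; last by lia.
  split=> [|i i0]; first by rewrite /irr_cols; lia.
  rewrite aE // part_two_blocks // /cols.
  by case: (leqP i m); case: (leqP i (m + l)); lia.
have [/and3P[pq rq cpr] tE] := h.
have t_sorted := has_cols_sorted h.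
have [||a at_] := @intpartP n t => //.
  by move=> i i0; rewrite !tE //; apply: cols_anti.
exists a => //; exists q, (r - q); rewrite at_; split; try lia.
apply/nonzero_partsP => //; first exact: all_two_blocks.
move=> i i0; rewrite tE // part_two_blocks // /cols p0 c2.
by case: (leqP i q); case: (leqP i (q + (r - q))); lia.
Qed.

(** * Disjointness and exhaustiveness of the pieces *)

Lemma bigsetU_nthP T (s : seq (set T)) (t : T) :
  (\big[setU/set0]_(A <- s) A) t <-> exists k, nth set0 s k t.
Proof.
elim: s => [|A s IHs]; first by rewrite big_nil; split=> // -[[]].
rewrite big_cons; split=> [[At|/IHs[k kt]]|[[|k] kt]].
- by exists 0.
- by exists k.+1.
- by left.
- by right; apply/IHs; exists k.
Qed.

(* [k] is the index of the piece in the sequence [pieces] of the theorem. *)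
Definition in_piece n k p q c r :=
  [|| [&& k == 0, p == 0, q == 1 & 2 < c],
      [&& k == 1, p == 1 & 1 < c],
      (k == 2) && grown 0 (pred1 1) p q c r,
      (k == 3) && grown 0 (leq 2) p q c r,
      (3 < k < n + 3) && grown (k - 3) predT p q c r,
      [&& k == n + 3, p == 1 & c == 1] |
      [&& k == n + 4, p == 0, c == 2 & 0 < r]].

Lemma in_piece_inj n k k' p q c r : irr_cols p q c r ->
  in_piece n k p q c r -> in_piece n k' p q c r -> k = k'.
Proof.
by case: p => [|[|p]]; rewrite /in_piece /grown /irr_cols /= ?andbF ?andbT /=; lia.
Qed.

Lemma in_piece_total n (t : n.+1.-tuple nat) p q c r : 2 < n ->
  sumn t = n.+1 -> has_cols t p q c r -> exists k, in_piece n k p q c r.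
Proof.
move=> n3 t_sum h; have [irr tE] := h.
(* Keeps the plateau indices [p + 1] and [q + 1] chosen below within range. *)
have qn : q <= n.+1.
  rewrite leqNgt; apply/negP => nq; move: irr; rewrite /irr_cols.
  by have := part_default t nq; rewrite (has_cols_le h); lia.
(* These are the coordinates of the partition (2) of 2, the only admissible ones outside every
   piece; here the sum is at least 4. *)
have not_two : ~~ [&& p == 0, q == 1, c == 2 & r == 0].
  apply/negP => /and4P[/eqP p0 /eqP q1 /eqP c2 /eqP r0].
  have := psum_sumn t; rewrite t_sum (@eq_psum _ (fun i => (i == 1) + (i == 1))).
    by rewrite big_split /= !sum_eq_index //; lia.
  by move=> i /andP[i0 _]; rewrite tE // /cols p0 q1 c2 r0; case: (ltngtP i 1); lia.
move: irr not_two; rewrite /irr_cols /in_piece /grown {h tE} => irr not_two.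
have [p0|p_pos] := posnP p; last first.
  have [p1|?] := eqVneq p 1.
    by exists (if c == 1 then n + 3 else 1); case: (eqVneq c 1); lia.
  have [p2|?] := eqVneq p 2; last by exists p.+1; rewrite /=; lia.
  by exists (if c == 1 then 2 else 3); case: (eqVneq c 1) => /=; lia.
have [c2|?] := boolP ((c == 2) && (0 < r)); first by exists (n + 4); lia.
have [q1|?] := eqVneq q 1; first by exists 0; lia.
have [q2|?] := eqVneq q 2; last by exists q.+1; rewrite /=; lia.
by exists (if c == 2 then 2 else 3); case: (eqVneq c 2) => /=; lia.
Qed.

Theorem theorem3 (n : nat) (hn : 3 <= n) :
  let pieces : seq (set (n.+1.-tuple nat)) :=
    [:: darrow 1 @` (J n `&` Cl n);
        darrow 1 @` (J n `&` NP n);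
        darrow 2 @` (J n `&` Ss n);
        darrow 2 @` (J n `&` NS n)]
    ++ [seq darrow l.+2 @` (J n `&` PP n l) | l <- index_iota 1 n]
    ++ [:: pval (n := n.+1) @` E1 n.+1; pval (n := n.+1) @` E2 n.+1] in
  trivIset [set: nat] (nth set0 pieces) /\
  pval (n := n.+1) @` J n.+1 = \big[setU/set0]_(A <- pieces) A.
Proof.
move=> pieces.
have n0 : 0 < n by apply: ltnW (ltnW hn).
have piecesP k t : nth set0 pieces k t <-> sumn t = n.+1 /\ exists p q c r,
    has_cols t p q c r /\ in_piece n k p q c r.
  have step (A : set (n.+1.-tuple nat)) (P : nat -> nat -> nat -> nat -> bool) :
      (A t <-> sumn t = n.+1 /\ exists p q c r, has_cols t p q c r /\ P p q c r) ->
      (forall p q c r, in_piece n k p q c r = P p q c r) ->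
      A t <-> sumn t = n.+1 /\ exists p q c r,
        has_cols t p q c r /\ in_piece n k p q c r.
    by move=> AP QP; rewrite AP; split=> -[? [p [q [c [r [? ?]]]]]]; split=> //;
      exists p, q, c, r; rewrite ?QP // -QP.
  rewrite /pieces nth_cat; case: (ltnP k 4) => /= k4.
    case: k k4 step => [|[|[|[|//]]]] _ /= step.
    - apply: step (image_darrow_first t _) _ => [|p q c r]; first lia.
      by rewrite /in_piece /=; lia.
    - apply: step (image_darrow_plateau t) _ => p q c r.
      by rewrite /in_piece /=; lia.
    - have SsE (a : intpart n) p q c r :
          has_cols a p q c r -> Ss n a <-> p = 1 /\ pred1 1 c.
        by move=> h; rewrite /Ss /= (slippery_step_cols h); split=> -[-> /eqP].
      apply: step (image_darrow_grown t n0 SsE) _ => p q c r.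
      by rewrite /in_piece /=; lia.
    - have NSE (a : intpart n) p q c r :
          has_cols a p q c r -> NS n a <-> p = 1 /\ leq 2 c.
        exact: non_slippery_step_cols.
      apply: step (image_darrow_grown t n0 NSE) _ => p q c r.
      by rewrite /in_piece /=; lia.
  (* The plateau pieces occupy indices 4 to [n + 2], the one at index [k] having [l = k - 3]. *)
  rewrite nth_cat size_map size_iota; case: (ltnP (k - 4) (n - 1)) => kn.
    rewrite (nth_map 0) ?size_iota // nth_iota //.
    have PPE (a : intpart n) p q c r : has_cols a p q c r ->
        PP n (1 + (k - 4)) a <-> p = (1 + (k - 4)).+1 /\ predT c.
      by move=> h; rewrite /PP /= (slippery_plateau_cols _ h) //; split=> [|[]].
    have l_n : 1 + (k - 4) < n by lia.
    apply: step (image_darrow_grown t l_n PPE) _ => p q c r.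
    by rewrite /in_piece (_ : k - 3 = 1 + (k - 4)); lia.
  case: (eqVneq k (n + 3)) => [k_eq|?].
    rewrite (_ : k - 4 - (n - 1) = 0) /=; last lia.
    apply: step (image_E1 t _) _ => [|p q c r]; first lia.
    by rewrite /in_piece; lia.
  case: (eqVneq k (n + 4)) => [k_eq|?].
    rewrite (_ : k - 4 - (n - 1) = 1) /=; last lia.
    apply: step (image_E2 t) _ => p q c r.
    by rewrite /in_piece; lia.
  rewrite nth_default /=; last lia.
  by split=> // -[_ [p [q [c [r [_]]]]]]; rewrite /in_piece; lia.
split.
  (* A common element has unique coordinates, and these determine the index. *)
  move=> k k' _ _ [t [/piecesP[_ [p [q [c [r [h kp]]]]]]]].
  move=> /piecesP[_ [p' [q' [c' [r' [h' kp']]]]]].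
  have [ep eq_q ec er] := has_cols_inj h h'; subst.
  by apply: in_piece_inj kp kp'; case: h.
apply/seteqP; split=> t.
  move=> /image_J[t_sum [p [q [c [r h]]]]]; apply/bigsetU_nthP.
  have [k kp] := in_piece_total hn t_sum h; exists k.
  by apply/piecesP; split=> //; exists p, q, c, r.
move=> /bigsetU_nthP[k /piecesP[t_sum [p [q [c [r [h _]]]]]]].
by apply/image_J; split=> //; exists p, q, c, r.
Qed.
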